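(* Let $C>0$. There exists an infinite commutative graph $G$ (with layers $V_0,V_1,V_2,\dots$, $V_0\neq\emptyset$) satisfying $D_i(G)=C^i$ for all $i\ge 1$ if and only if $C=1$.
   Context: An infinite directed layered graph $G$ has vertex set $V(G)=\bigcup_{i\ge 0}V_i$, a disjoint union of finite sets (layers), and every directed edge goes from some $V_i$ to $V_{i+1}$. For a vertex $x$, $\operatorname{im}(x)$ denotes its set of out-neighbours and $\operatorname{im}^{-1}(x)$ its set of in-neighbours. For $Z\subseteq V(G)$, $\operatorname{im}^{(i)}(Z)$ is the set of vertices $v$ for which there is a directed path with $i$ edges starting in $Z$ and ending at $v$. $G$ is commutative (a Plünnecke graph) if: (upward condition) for every edge $uv$ there is an injective map $\varphi:\operatorname{im}(v)\to\operatorname{im}(u)$ with $\varphi(x)x\in E(G)$ for all $x\in\operatorname{im}(v)$; and (downward condition) for every edge $vw$ there is an injective map $\psi:\operatorname{im}^{-1}(v)\to\operatorname{im}^{-1}(w)$ with $x\psi(x)\in E(G)$ for all $x\in\operatorname{im}^{-1}(v)$. The $i$-th magnification ratio is $D_i(G)=\min_{\emptyset\neq Z\subseteq V_0}|\operatorname{im}^{(i)}(Z)|/|Z|$. *)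

(* Defs.v *)
From HB Require Import structures.
From mathcomp Require Import all_boot all_order all_algebra finmap.
From mathcomp Require Import boolp classical_sets functions cardinality reals.

Set Implicit Arguments.
Unset Strict Implicit.
Unset Printing Implicit Defensive.

Import Order.TTheory GRing.Theory Num.Theory.

Local Open Scope classical_set_scope.
Local Open Scope fset_scope.
Local Open Scope ring_scope.

Record layered_graph := LayeredGraph {
  vertex :> choiceType;
  layer : nat -> {fset vertex};
  layer_cover : forall x : vertex, exists i, x \in layer i;
  layer_disjoint : forall (i j : nat) (x : vertex),
    x \in layer i -> x \in layer j -> i = j;
  edge : rel vertex;
  edge_layer : forall x y : vertex, edge x y ->
    exists i, x \in layer i /\ y \in layer i.+1
}.

Definition out_nbrs (G : layered_graph) (x : G) : set G := [set y | edge x y].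

Definition in_nbrs (G : layered_graph) (x : G) : set G := [set y | edge y x].

(* [path edge x p] says that x :: p is a directed path; it has [size p] edges
   and ends at [last x p]. *)
Definition iter_out (G : layered_graph) (i : nat) (Z : set G) : set G :=
  [set v | exists x : G, exists p : seq G,
     [/\ Z x, path (@edge G) x p, size p = i & last x p = v]].

(* The injections are total functions on the vertices of which only the
   restriction to the relevant neighbourhood matters. *)
Definition upward_condition (G : layered_graph) : Prop :=
  forall u v : G, edge u v ->
    exists phi : G -> G,
      [/\ set_inj (out_nbrs v) phi,
          forall x, out_nbrs v x -> out_nbrs u (phi x)
        & forall x, out_nbrs v x -> edge (phi x) x].

Definition downward_condition (G : layered_graph) : Prop :=
  forall v w : G, edge v w ->
    exists psi : G -> G,
      [/\ set_inj (in_nbrs v) psi,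
          forall x, in_nbrs v x -> in_nbrs w (psi x)
        & forall x, in_nbrs v x -> edge x (psi x)].

Definition commutative_graph (G : layered_graph) : Prop :=
  upward_condition G /\ downward_condition G.

(* [fset_set] is meaningful here: for Z included in layer 0, the set
   [iter_out i Z] is included in layer i, hence finite. *)
Definition expansion (R : realType) (G : layered_graph) (i : nat)
    (Z : {fset G}) : R :=
  #|` fset_set (iter_out i [set` Z]) |%:R / #|` Z|%:R.

(* When layer 0 is nonempty, the default value of the iterated minimum is one
   of the values the minimum ranges over. *)
Definition magnification_ratio (R : realType) (G : layered_graph)
    (i : nat) : R :=
  \big[Num.min/expansion R i (layer G 0)]_(Z <- fpowerset (layer G 0)
                                          | Z != fset0) expansion R i Z.

(* Main.v *)
(* Only the upward condition matters. It lets a path u -> a -> x be rerouted as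
   u -> phi x -> x, so, once the out-neighbours of u are ordered, the vertices
   at distance i + 1 from u are all reached by nondecreasing words in the d
   out-neighbour labels: there are at most 'C(d + i, i + 1) of them. For u in
   V_0 this bounds D_(i+1) by a polynomial in i, hence C <= 1. In the other
   direction, a positive magnification ratio is at least 1 / |V_0|, hence
   C >= 1. The directed ray realises C = 1. *)
From HB Require Import structures.
From mathcomp Require Import all_boot all_order all_algebra finmap.
From mathcomp Require Import boolp classical_sets functions cardinality reals.
Require Import Defs.

Set Implicit Arguments.
Unset Strict Implicit.
Unset Printing Implicit Defensive.

Import Order.TTheory GRing.Theory Num.Theory.

Local Open Scope classical_set_scope.
Local Open Scope fset_scope.
Local Open Scope ring_scope.

(** * Exponential against polynomial growth *)

Lemma binomial_term_le (R : realType) (h : R) (n k : nat) :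
  0 <= h -> h ^+ k *+ 'C(n, k) <= (1 + h) ^+ n.
Proof.
move=> h0; have [kn|nk] := leqP k n; last first.
  by rewrite bin_small // mulr0n exprn_ge0 // addr_ge0.
rewrite exprDn (bigD1 (Ordinal (kn : (k < n.+1)%N))) //=.
rewrite expr1n mul1r lerDl; apply: sumr_ge0 => i _.
by rewrite expr1n mul1r mulrn_wge0 // exprn_ge0.
Qed.

(** Bernoulli's inequality: for [C > 1], the linear term of [(1 + (C - 1)) ^+ i.+1] is already
    unbounded. *)
Lemma exp_bounded_le1 (R : realType) (C M : R) :
  (forall i, C ^+ i.+1 <= M) -> C <= 1.
Proof.
move=> CM; rewrite leNgt; apply/negP => C1.
have h0 : 0 < C - 1 by rewrite subr_gt0.
have M0 : 0 <= M by rewrite (le_trans _ (CM 0)) // expr1 ltW // (lt_trans _ C1).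
have Mh0 : 0 <= M / (C - 1) by rewrite divr_ge0 // ltW.
have := archi_boundP Mh0; set i := Num.bound _; rewrite ltr_pdivrMr //.
apply/negP; rewrite -leNgt (le_trans _ (CM i)) //.
have := binomial_term_le i.+1 1 (ltW h0).
rewrite subrKC bin1 expr1; apply: le_trans.
by rewrite mulr_natl ler_wpMn2l // ltW.
Qed.

(** For [d = k.+1] the bound is a polynomial of degree [k] in [i], while the term of index [k.+1] in
    the expansion of [(1 + (C - 1)) ^+ (k + i.+1)] has degree [k.+1] in [i]. *)
Lemma exp_le_binomial_le1 (R : realType) (C : R) (d : nat) :
  (forall i, C ^+ i.+1 <= 'C(d + i, i.+1)%:R) -> C <= 1.
Proof.
move=> Cbin; rewrite leNgt; apply/negP => C1.
have C0 : 0 < C by rewrite (lt_trans _ C1).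
case: d Cbin => [|k] Cbin.
  by have := Cbin 0; rewrite bin_small // leNgt exprn_gt0.
have h0 : 0 < C - 1 by rewrite subr_gt0.
have hk0 : 0 < (C - 1) ^+ k.+1 by rewrite exprn_gt0.
have M0 : 0 <= C ^+ k *+ k.+1 / (C - 1) ^+ k.+1.
  by rewrite divr_ge0 ?mulrn_wge0 // ?exprn_ge0 // ltW.
have := archi_boundP M0; set i := Num.bound _; rewrite ltr_pdivrMr //.
apply/negP; rewrite -leNgt.
have Ci0 : 0 < C ^+ i.+1 by rewrite exprn_gt0.
rewrite -(ler_pM2r Ci0) [leRHS]mulrnAl -exprD.
have := binomial_term_le (k + i.+1) k.+1 (ltW h0).
rewrite subrKC -(ler_pMn2r (ltn0Sn k)); apply: le_trans.
rewrite -mulrnA.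
(* The absorption identity exposes the extra factor [i.+1] over the assumed bound. *)
have -> : ('C(k + i.+1, k.+1) * k.+1 = i.+1 * 'C(k.+1 + i, i.+1))%N.
  rewrite mulnC mul_bin_left addKn addSnnS -(bin_sub (leq_addl k i.+1)).
  by rewrite addnK.
rewrite -[leRHS]mulr_natl mulrAC ler_pM2r // natrM.
by apply: ler_pM; rewrite ?ler0n ?ler_nat // ltW.
Qed.

(** * Growth of iterated out-neighbourhoods *)

Section Growth.
Variable G : layered_graph.
Implicit Types (u v x : G) (W Z : {fset G}).

Definition children u : {fset G} := fset_set (out_nbrs u).

(** All out-neighbours of [u] lie in one finite layer, so [fset_set] does not fall back on its
    default value. *)
Lemma childrenE u x : (x \in children u) = edge u x.
Proof.
rewrite in_fset_set; first by apply/idP/idP; rewrite inE.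
have [[y uy]|no_child] := pselect (exists y, edge u y).
  have [i [ui _]] := edge_layer uy.
  apply: (sub_finite_set _ (finite_fset (layer G i.+1))) => z uz.
  have [j [uj zj]] := edge_layer uz.
  by rewrite /= (layer_disjoint ui uj).
apply: (sub_finite_set _ (@finite_set0 G)) => z uz.
by apply: no_child; exists z.
Qed.

Definition step W : {fset G} := \bigcup_(x <- W) children x.

Definition reach i W : {fset G} := iter i step W.

Lemma stepP W x : reflect (exists2 w, w \in W & edge w x) (x \in step W).
Proof.
apply: (iffP (bigfcupP _ _ _ _)) => -[w wW wx]; exists w => //.
- by move: wW; rewrite andbT.
- by rewrite -childrenE.
- by rewrite andbT.
- by rewrite childrenE.
Qed.

Lemma reachS i W : reach i.+1 W = reach i (step W).
Proof. exact: iterSr. Qed.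

Lemma step_fset1 u : step [fset u] = children u.
Proof.
apply/fsetP => x; rewrite childrenE; apply/stepP/idP => [[w]|ux].
  by rewrite inE => /eqP ->.
by exists u; rewrite ?inE.
Qed.

Lemma stepS W Z : W `<=` Z -> step W `<=` step Z.
Proof.
move=> /fsubsetP WZ; apply/fsubsetP => x /stepP[w /WZ wZ wx].
by apply/stepP; exists w.
Qed.

Lemma stepU W Z : step (W `|` Z) = step W `|` step Z.
Proof.
apply/fsetP => x; rewrite inE; apply/stepP/orP => [[w]|].
  by rewrite inE => /orP[] wW wx; [left|right]; apply/stepP; exists w.
by case=> /stepP[w wW wx]; exists w; rewrite // inE wW ?orbT.
Qed.

Lemma reach_sub i W Z : W `<=` Z -> reach i W `<=` reach i Z.
Proof. by move=> WZ; elim: i => //= i; apply: stepS. Qed.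

Lemma reachU i W Z : reach i (W `|` Z) = reach i W `|` reach i Z.
Proof. by elim: i => //= i ->; rewrite stepU. Qed.

(** Turns paths into iterated finite neighbourhoods, so that [fset_set] in [expansion] can be
    cancelled. *)
Lemma iter_outE i W : iter_out i [set` W] = [set` reach i W].
Proof.
apply/seteqP; split => v /=.
  case=> x [p []]; elim: i W x p => [|i IHi] W x [|y p] //= xW.
    by move=> _ _ <-.
  move=> /andP[xy yp] [sp] lp; rewrite (_ : step _ = reach i.+1 W) // reachS.
  by apply: (IHi _ y p) => //; apply/stepP; exists x.
rewrite -/(reach i W); elim: i W => [|i IHi] W.
  by move=> vW; exists v, [::].
rewrite reachS => /IHi[x [p [/stepP[w wW wx] xp sp lp]]].
by exists w, (x :: p); split=> //=; rewrite ?wx ?sp.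
Qed.

Hypothesis up : upward_condition G.

(* Move a vertex a of [children u `\` W] into W and apply Pascal's rule: a path
   u -> a -> x is rerouted through phi x, so its continuations are already
   reached from W when phi x is in W, and the other x inject into
   [children u `\` W]. *)
Lemma card_reachD i k u W : (#|` children u `\` W| <= k)%N ->
  (#|` reach i (children u) `\` reach i W| <= 'C(k + i, i.+1))%N.
Proof.
elim: i k u W => [|i IHi] k u W; first by rewrite addn0 bin1.
elim: k W => [|k IHk] W kW.
  move: kW; rewrite leqn0 cardfs_eq0 fsetD_eq0 => /(reach_sub i.+1).
  by rewrite -fsetD_eq0 => /eqP ->; rewrite cardfs0.
have [D0|[a]] := fset_0Vmem (children u `\` W).
  apply: leq_trans (IHk W _) _; first by rewrite D0 cardfs0.
  by rewrite leq_bin2l // addSn.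
rewrite inE childrenE => /andP[aW ua].
have [phi [phi_inj phi_u phi_x]] := up ua.
pose W' := [fset x in children a | phi x \in W].
have W'W : W' `<=` step W.
  apply/fsubsetP => x; rewrite !inE /= childrenE => /andP[ax phiW].
  by apply/stepP; exists (phi x) => //; apply: phi_x.
have kW' : (#|` children a `\` W'| <= k.+1)%N.
  (* Off [W'], [phi] takes values outside [W], so it maps into [children u] minus [W]. *)
  have /card_in_imfsetP/eqP <- : {in children a `\` W' &, injective phi}.
    move=> x y; rewrite !inE !childrenE => /andP[_ ax] /andP[_ ay].
    by apply: phi_inj; rewrite inE.
  apply: leq_trans kW; apply/fsubset_leq_card/fsubsetP => _ /imfsetP[x /= + ->].
  rewrite !inE /= !childrenE => /andP[+ ax]; rewrite ax /= => ->.
  exact: phi_u.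
have kaW : (#|` children u `\` (a |` W)| <= k)%N.
  rewrite -ltnS; apply: leq_trans kW; rewrite [X in (_ < X)%N](cardfsD1 a).
  rewrite !inE aW childrenE ua add1n ltnS.
  apply/fsubset_leq_card/fsubsetP => x; rewrite !inE negb_or.
  by case/andP => /andP[-> ->] ->.
have := IHi _ _ _ kW'; rewrite addSnnS => /(leq_add (IHk _ kaW)).
rewrite addSn binS; apply: leq_trans.
apply: leq_trans (leq_card_fsetU _ _).
apply/fsubset_leq_card/fsubsetP => x.
rewrite reachU [reach i.+1 [fset a]]reachS step_fset1 !inE => /andP[xW xu].
rewrite xu andbT (negbTE xW) orbF; case: (boolP (x \in reach i (children a))) => //=.
rewrite andbT => _; apply: contra xW => xW'.
by rewrite reachS (fsubsetP (reach_sub i W'W)).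
Qed.

(** The case [W = fset0] of [card_reachD], with [k] the out-degree of [u]. *)
Lemma card_iter_out1 i u :
  (#|` fset_set (iter_out i.+1 [set` [fset u]]) |
     <= 'C(#|` children u| + i, i.+1))%N.
Proof.
rewrite iter_outE set_fsetK reachS step_fset1.
have := @card_reachD i _ u fset0 (leqnn _).
have -> : reach i fset0 = fset0.
  elim: i => //= i ->; apply/fsetP => x; rewrite inE.
  by apply/stepP => -[].
by rewrite !fsetD0.
Qed.

End Growth.

(** * Bounds on magnification ratios *)

Section Magnification.
Variables (R : realType) (G : layered_graph).

Lemma magnification_ratio_le i (Z : {fset G}) :
  Z `<=` layer G 0 -> Z != fset0 ->
  magnification_ratio R G i <= expansion R i Z.
Proof. by move=> Z0 ?; apply: ge_bigmin_seq => //; rewrite fpowersetE. Qed.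

Lemma magnification_ratio_ge i (r : R) : layer G 0 != fset0 ->
  (forall Z : {fset G}, Z `<=` layer G 0 -> Z != fset0 ->
     r <= expansion R i Z) ->
  r <= magnification_ratio R G i.
Proof.
move=> V0 rZ; rewrite /magnification_ratio big_seq_cond; apply: le_bigmin.
  (* The default value of the minimum is the expansion of layer 0 itself. *)
  exact: rZ.
by move=> Z /andP[]; rewrite fpowersetE; apply: rZ.
Qed.

(** Positivity forces every image to be nonempty, so each expansion is at least the inverse of the
    size of its set. *)
Lemma magnification_ratio_gt0 i : layer G 0 != fset0 ->
  0 < magnification_ratio R G i ->
  1 <= magnification_ratio R G i * #|` layer G 0|%:R.
Proof.
move=> V0 D0; have n0 : 0 < #|` layer G 0|%:R :> R.
  by rewrite ltr0n cardfs_gt0.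
rewrite -ler_pdivrMr // div1r; apply: magnification_ratio_ge => // Z ZV0 Z0.
have z0 : 0 < #|` Z|%:R :> R by rewrite ltr0n cardfs_gt0.
have := lt_le_trans D0 (magnification_ratio_le i ZV0 Z0).
rewrite /expansion pmulr_lgt0 ?invr_gt0 // ltr0n => im0.
rewrite (le_trans (y := #|` Z|%:R^-1)) //.
  by rewrite lef_pV2 // ler_nat fsubset_leq_card.
by apply: ler_peMl; [rewrite invr_ge0 ltW|rewrite ler1n].
Qed.

End Magnification.

(** * The directed ray *)

Section Ray.

Lemma ray_cover (x : nat) : exists i, x \in [fset i].
Proof. by exists x; rewrite inE. Qed.

Lemma ray_disjoint (i j x : nat) : x \in [fset i] -> x \in [fset j] -> i = j.
Proof. by rewrite !inE => /eqP <- /eqP <-. Qed.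

Lemma ray_edge_layer (x y : nat) : y == x.+1 ->
  exists i, x \in [fset i] /\ y \in [fset i.+1].
Proof. by move=> /eqP ->; exists x; rewrite !inE. Qed.

Definition ray := @LayeredGraph nat (fun i => [fset i]) ray_cover ray_disjoint
  (fun x y => y == x.+1) ray_edge_layer.

Lemma ray_commutative : commutative_graph ray.
Proof.
(* The sets to be mapped have at most one element, so a constant map is injective on them. *)
split=> [u v|v w] /eqP vw; exists (fun=> v); split.
- by move=> x y; rewrite !inE => /eqP -> /eqP ->.
- by move=> x _; apply/eqP.
- by move=> x.
- by move=> x y; rewrite !inE => /eqP + /eqP; move=> -> [].
- by move=> x _; apply/eqP.
- by move=> x.
Qed.

Lemma reach_ray i (x : ray) : reach i [fset x] = [fset (x + i)%N].
Proof.
elim: i => [|i IHi] /=; first by rewrite addn0.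
rewrite -/(reach i _) IHi step_fset1; apply/fsetP => y.
by rewrite [LHS](@childrenE ray) inE addnS.
Qed.

Lemma magnification_ratio_ray (R : realType) i : magnification_ratio R ray i = 1.
Proof.
have exp1 : expansion R i (layer ray 0) = 1.
  rewrite /expansion iter_outE set_fsetK reach_ray !cardfs1 divr1 //.
rewrite /magnification_ratio big_seq_cond exp1.
apply: (big_ind (fun x => x = 1)) => [//|_ _ -> ->|Z]; first by rewrite minxx.
rewrite fpowersetE fsubset1 => /andP[/orP[/eqP -> _|-> //]].
exact: exp1.
Qed.

End Ray.

Theorem theorem3 (R : realType) (C : R) (hC : 0 < C) :
  (exists G : layered_graph,
     [/\ layer G 0 != fset0,
         commutative_graph G
       & forall i : nat, (1 <= i)%N -> magnification_ratio R G i = C ^+ i])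
  <-> C = 1.
Proof.
split=> [[G [V0 [up _] DC]]|->]; last first.
  exists ray; split=> [||i _]; first by rewrite -cardfs_gt0 cardfs1.
    exact: ray_commutative.
  by rewrite expr1n magnification_ratio_ray.
apply/le_anti/andP; split.
  (* Upper bound on [C]: test the ratio on a single vertex. *)
  have /fset0Pn[u uV0] := V0.
  apply: (@exp_le_binomial_le1 _ _ #|` children u|) => i; rewrite -DC //.
  apply: le_trans (@magnification_ratio_le R G i.+1 [fset u] _ _) _.
  - by rewrite fsub1set.
  - by rewrite -cardfs_gt0 cardfs1.
  by rewrite /expansion cardfs1 divr1 ler_nat card_iter_out1.
(* Lower bound on [C]: the powers of its inverse are bounded by the size of layer 0. *)
rewrite -invf_le1 //; apply: (@exp_bounded_le1 _ _ #|` layer G 0|%:R) => i.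
rewrite exprVn -[leLHS]mulr1 ler_pdivrMl ?exprn_gt0 // -DC //.
by rewrite magnification_ratio_gt0 // DC // exprn_gt0.
Qed.
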